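(* Let $1\le p<\infty$, let $w$ be a doubling weight on $\mathbb{R}^n$, and let $f\in RBV^p(\mathbb{R}^n,w)$. Then there is a constant $C>0$, independent of $f$ and $t$, such that for all $t>0$, $$w\big(\{x\in\mathbb{R}^n: L_f(x)>t\}\big)\le C\Big(\frac{V_p(f;\mathbb{R}^n,w)}{t}\Big)^p.$$
   Context: A weight is a non-negative, locally integrable function $w$ on $\mathbb{R}^n$, and $w(E)=\int_E w(x)\,dx$. For a ball $B=B(x,r)$ let $2B=B(x,2r)$. A weight $w$ is doubling if there is a constant $C'$ such that $w(2B)\le C' w(B)$ for every ball $B$. For $f:\mathbb{R}^n\to\mathbb{R}$, the local Lipschitz constant at $x$ is $$L_f(x)=\limsup_{y\to x}\frac{|f(x)-f(y)|}{|x-y|}\in[0,\infty].$$ For $E\subset\mathbb{R}^n$, $\operatorname{osc}_E(f)=\sup_{x,y\in E}|f(x)-f(y)|$. The weighted Riesz $p$-variation of a measurable $f:\mathbb{R}^n\to\mathbb{R}$ is $$V_p(f;\mathbb{R}^n,w)=\sup\Big[\sum_{B_k\in\mathcal{D}}\Big(\frac{\operatorname{osc}_{B_k}(f)}{r_k}\Big)^p w(B_k)\Big]^{1/p},$$ where the supremum is over all countable collections $\mathcal{D}=\{B_k\}$ of pairwise disjoint open balls $B_k\subset\mathbb{R}^n$ of radius $r_k$. $RBV^p(\mathbb{R}^n,w)$ is the set of measurable $f:\mathbb{R}^n\to\mathbb{R}$ with $V_p(f;\mathbb{R}^n,w)<\infty$. *)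

(* Defs.v *)
From HB Require Import structures.
From mathcomp Require Import all_boot all_order all_algebra.
From mathcomp Require Import all_classical all_reals all_analysis.

Set Implicit Arguments.
Unset Strict Implicit.
Unset Printing Implicit Defensive.

Import Order.TTheory GRing.Theory Num.Theory.
Import numFieldNormedType.Exports.

Local Open Scope classical_set_scope.
Local Open Scope ring_scope.

(* R^n is 'rV[R]_n.  The library norm on 'rV[R]_n is the max norm; it induces
   the usual topology, but balls and distances must use enorm and eball. *)

Section Euclidean.
Context {R : realType} {n : nat}.
Implicit Types x y : 'rV[R]_n.

Definition enorm x : R := Num.sqrt (\sum_(i < n) x ord0 i ^+ 2).

Definition eball x (r : R) : set 'rV[R]_n := [set y | enorm (y - x) < r].

End Euclidean.

(* n-dimensional Lebesgue measure, obtained from the outer measure by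
   Caratheodory's construction; countable covers by boxes may be finite. *)

Section LebesgueMeasure.
Context (R : realType) (n : nat).
Local Open Scope ereal_scope.
Implicit Types (b : 'rV[R]_n * 'rV[R]_n) (A : set 'rV[R]_n).

Definition box b : set 'rV[R]_n :=
  [set x | forall i, (b.1 ord0 i < x ord0 i <= b.2 ord0 i)%R].

Definition box_vol b : R :=
  (\prod_(i < n) Num.max 0 (b.2 ord0 i - b.1 ord0 i))%R.

Definition box_cover A : set (set ('rV[R]_n * 'rV[R]_n)) :=
  [set D | countable D /\ A `<=` \bigcup_(b in D) box b].

Definition lebesgue_outer A : \bar R :=
  ereal_inf [set \esum_(b in D) (box_vol b)%:E | D in box_cover A].

Let box_vol_ge0 b : 0 <= (box_vol b)%:E.
Proof. by rewrite lee_fin; apply: prodr_ge0 => i _; rewrite le_max lexx. Qed.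

Let lebesgue_outer0 : lebesgue_outer set0 = 0.
Proof.
apply/eqP; rewrite eq_le; apply/andP; split.
  by apply: ereal_inf_lbound; exists set0; [split|rewrite esum_set0].
by apply: le_ereal_inf_tmp => _ [D _ <-]; exact: esum_ge0.
Qed.

Let lebesgue_outer_ge0 A : 0 <= lebesgue_outer A.
Proof. by apply: le_ereal_inf_tmp => _ [D _ <-]; exact: esum_ge0. Qed.

Let le_lebesgue_outer : {homo lebesgue_outer : A B / A `<=` B >-> A <= B}.
Proof.
move=> A B AB; apply: le_ereal_inf_tmp => _ [D [cD BD] <-].
by apply: ereal_inf_lbound; exists D => //; split => //; exact: subset_trans BD.
Qed.

Let lebesgue_outer_sigma_subadditive : sigma_subadditive lebesgue_outer.
Proof.
move=> A; have [[i ioo]|] := pselect (exists i, lebesgue_outer (A i) = +oo).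
  rewrite (eseries_pinfty _ _ ioo) ?leey// => k _.
  by rewrite -ltNye (lt_le_trans _ (lebesgue_outer_ge0 _)).
rewrite -forallNE => Aoo.
apply/lee_addgt0Pr => _/posnumP[e].
rewrite (le_trans _ (epsilon_trick _ _ _))//.
have [D PD] : {D : nat -> set ('rV[R]_n * 'rV[R]_n) & forall k,
    box_cover (A k) (D k) /\ \esum_(b in D k) (box_vol b)%:E <=
      lebesgue_outer (A k) + (e%:num / (2 ^ k.+1)%:R)%:E}.
  apply: (@choice _ _ (fun k D => box_cover (A k) D /\
    \esum_(b in D) (box_vol b)%:E <=
      lebesgue_outer (A k) + (e%:num / (2 ^ k.+1)%:R)%:E)) => k.
  have en1 : (0 < e%:num / (2 ^ k.+1)%:R)%R by [].
  have fA : lebesgue_outer (A k) \is a fin_num.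
    by rewrite ge0_fin_numE// ltey; apply/eqP; exact: Aoo.
  have [_ [D cD <-] Dlt] := lb_ereal_inf_adherent en1 fA.
  by exists D; split => //; exact: ltW.
apply: (@le_trans _ _ (\esum_(b in \bigcup_k D k) (box_vol b)%:E)).
  apply: ereal_inf_lbound; exists (\bigcup_k D k) => //; split.
    by apply: bigcup_countable => // k _; have [[]] := PD k.
  move=> x [k _ Akx]; have [[_ /(_ _ Akx)[b Db bx]] _] := PD k.
  by exists b => //; exists k.
rewrite seqDU_bigcup_eq nneseries_sum_bigcup//.
apply: lee_nneseries => [k _ _|k _]; first exact: esum_ge0.
apply: le_trans (PD k).2.
rewrite [leRHS](esumID (seqDU D k))// setIidr; last exact: subset_seqDU.
by rewrite leeDl//; exact: esum_ge0.
Qed.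

HB.instance Definition _ := isOuterMeasure.Build R 'rV[R]_n lebesgue_outer
  lebesgue_outer0 lebesgue_outer_ge0 le_lebesgue_outer
  lebesgue_outer_sigma_subadditive.

(* R^n with the sigma-algebra of Lebesgue measurable sets. *)
Definition lebRn : Type := caratheodory_type lebesgue_outer.

HB.instance Definition _ := Measurable.copy lebRn
  (caratheodory_type lebesgue_outer).

Definition lebesgue_rV : set lebRn -> \bar R := lebesgue_outer.

HB.instance Definition _ := isMeasure.Build _ lebRn R lebesgue_rV
  (@caratheodory_measure0 R 'rV[R]_n lebesgue_outer)
  (@caratheodory_measure_ge0 R 'rV[R]_n lebesgue_outer)
  (@caratheodory_measure_sigma_additive R 'rV[R]_n lebesgue_outer).

End LebesgueMeasure.
Arguments lebesgue_rV R n : clear implicits.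

Section RieszVariation.
Context {R : realType} {n : nat}.
Local Open Scope ereal_scope.
Implicit Types (w f : 'rV[R]_n -> R) (E : set 'rV[R]_n).

Definition lebesgue_measurable_fun f : Prop :=
  measurable_fun [set: lebRn R n] (f : lebRn R n -> R).

Definition weight w : Prop :=
  [/\ lebesgue_measurable_fun w,
      forall x, (0 <= w x)%R &
      forall K : set 'rV[R]_n, compact K ->
        \int[lebesgue_rV R n]_(x in K) (w x)%:E < +oo].

Definition wmeas w E : \bar R := \int[lebesgue_rV R n]_(x in E) (w x)%:E.

Definition doubling w : Prop :=
  exists C' : R, forall (x : 'rV[R]_n) (r : R), (0 < r)%R ->
    wmeas w (eball x (2 * r)) <= C'%:E * wmeas w (eball x r).

Definition local_lip f (x : 'rV[R]_n) : \bar R :=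
  limf_esup (fun y => (`|f x - f y| / enorm (x - y))%:E) x^'.

Definition oscillation E f : \bar R :=
  ereal_sup [set (`|f xy.1 - f xy.2|)%:E | xy in E `*` E].

(* A ball is represented by its (center, radius) pair. *)
Definition ball_packing (D : set ('rV[R]_n * R)) : Prop :=
  [/\ countable D,
      forall b, D b -> (0 < b.2)%R &
      trivIset D (fun b => eball b.1 b.2)].

(* If osc_B f = +oo and w(B) = 0, the term of B is +oo * 0 = 0. *)
Definition riesz_sum (p : R) w f (D : set ('rV[R]_n * R)) : \bar R :=
  \esum_(b in D) ((oscillation (eball b.1 b.2) f * (b.2^-1)%:E) `^ p
                  * wmeas w (eball b.1 b.2)).

Definition riesz_variation (p : R) w f : \bar R :=
  (ereal_sup [set riesz_sum p w f D | D in ball_packing]) `^ p^-1.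

Definition RBV (p : R) w : set ('rV[R]_n -> R) :=
  [set f | lebesgue_measurable_fun f /\ riesz_variation p w f < +oo].

End RieszVariation.

(* Main.v *)
Require Import Defs.
From HB Require Import structures.
From mathcomp Require Import all_boot all_order all_algebra.
From mathcomp Require Import all_classical all_reals all_analysis.
From mathcomp Require Import measurable_realfun lra.

Set Implicit Arguments.
Unset Strict Implicit.
Unset Printing Implicit Defensive.

Import Order.TTheory GRing.Theory Num.Theory.
Import numFieldNormedType.Exports.

Local Open Scope classical_set_scope.
Local Open Scope ring_scope.
Local Open Scope ereal_scope.

(** If [L_f(x) > t], there are points [y] as close to [x] as one likes with
    [|f(x) - f(y)| > t |x - y|].  The ball [B] centred at [x] of radius
    [r = 2|x - y|] contains both points, so that [osc_B(f) / r >= t / 2]: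
    on [B] the difference quotient seen by the Riesz variation is already
    comparable with [t] ([local_lip_ball]).  Radii may be kept below 2, hence
    Vitali's selection principle extracts from these balls a disjoint family
    [D] whose fourfold dilates still contain every centre, i.e. cover
    [E = {L_f > t}] ([eball_packing]).  With [K] a doubling constant,
    [[
       w(E) <= sum_D w(4B) <= K^2 sum_D w(B)
            <= K^2 (2/t)^p sum_D (osc_B(f) / r)^p w(B)
            <= K^2 2^p (V_p(f) / t)^p.
    ]]
    The first inequality is the countable subadditivity of [w] on covers by
    balls ([wmeas_cover_le]).  It rests on the measurability of Euclidean balls
    for the Caratheodory extension of the volume of boxes ([measurable_eball]):
    cutting a box by a coordinate hyperplane gives two boxes whose volumes add
    up, so half-spaces, and with them the coordinate functions, are measurable.
    The measurability of [E] is bypassed: for a non-negative integrand the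
    integral over any set is a supremum over simple functions lying below, and
    this is enough to bound it by the integral over a larger set
    ([ge0_subset_integral_any]). *)

(** * The Euclidean norm and its balls *)

Section EuclideanNorm.
Context {R : realType} {n : nat}.
Implicit Types x y : 'rV[R]_n.
Local Open Scope ring_scope.

Lemma enorm_ge0 x : 0 <= enorm x.
Proof. exact: sqrtr_ge0. Qed.

Lemma sqr_enorm x : enorm x ^+ 2 = \sum_(i < n) x ord0 i ^+ 2.
Proof. by rewrite sqr_sqrtr// sumr_ge0// => i _; exact: sqr_ge0. Qed.

Lemma enormN x : enorm (- x) = enorm x.
Proof. by rewrite /enorm; under eq_bigr do rewrite mxE sqrrN. Qed.

Lemma enormB x y : enorm (x - y) = enorm (y - x).
Proof. by rewrite -enormN opprB. Qed.

Lemma enorm_eq0 x : enorm x = 0 -> x = 0.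
Proof.
move=> x0; apply/rowP => i; rewrite mxE; apply/eqP; rewrite -sqrf_eq0.
have /eqP := sqr_enorm x; rewrite x0 expr0n/= eq_sym psumr_eq0.
  by move=> /allP/(_ i); apply; exact: mem_index_enum.
by move=> j _; exact: sqr_ge0.
Qed.

Lemma cauchy_schwarz x y :
  \sum_(i < n) x ord0 i * y ord0 i <= enorm x * enorm y.
Proof.
have [x0|x0] := eqVneq (enorm x) 0.
  rewrite x0 mul0r big1// => i _.
  by rewrite (enorm_eq0 x0) mxE mul0r.
have [y0|y0] := eqVneq (enorm y) 0.
  rewrite y0 mulr0 big1// => i _.
  by rewrite (enorm_eq0 y0) mxE mulr0.
set a := enorm x in x0 *; set b := enorm y in y0 *.
have ab0 : 0 < a * b by rewrite mulr_gt0// lt_def ?x0 ?y0 enorm_ge0.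
rewrite -(ler_pM2l (mulr_gt0 (ltr0Sn _ 1) ab0)) mulr_sumr.
(* sum over the coordinates of 2 (b x_i) (a y_i) <= (b x_i)^2 + (a y_i)^2 *)
apply: (@le_trans _ _ (\sum_(i < n)
    (b ^+ 2 * x ord0 i ^+ 2 + a ^+ 2 * y ord0 i ^+ 2))).
  by apply: ler_sum => i _; have := sqr_ge0 (b * x ord0 i - a * y ord0 i); nra.
by rewrite big_split/= -!mulr_sumr -!sqr_enorm -/a -/b; lra.
Qed.

Lemma enormD x y : enorm (x + y) <= enorm x + enorm y.
Proof.
rewrite -(@ler_pXn2r _ 2)// ?nnegrE ?addr_ge0 ?enorm_ge0//.
rewrite sqrrD !sqr_enorm.
under eq_bigr do rewrite mxE sqrrD.
rewrite !big_split/= lerD2r lerD2l -mulr2n ler_pMn2r//.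
exact: cauchy_schwarz.
Qed.

(** Compares Euclidean balls with boxes: any [c] with [n c^2 < 1] would do as a
    factor, and [1 / (n + 1)] avoids a square root and the case [n = 0]. *)
Lemma enorm_lt_coord x (e : R) : 0 < e ->
  (forall i, `|x ord0 i| <= e / n.+1%:R) -> enorm x < e.
Proof.
move=> e0 xe; rewrite -(@ltr_pXn2r _ 2)// ?nnegrE ?enorm_ge0 ?ltW//.
rewrite sqr_enorm; apply: (@le_lt_trans _ _ (\sum_(i < n) (e / n.+1%:R) ^+ 2)).
  apply: ler_sum => i _; rewrite -real_normK ?num_real// lerXn2r ?nnegrE//.
  by rewrite divr_ge0// ltW.
rewrite sumr_const card_ord -[ltLHS]mulr_natl.
have n0 : (0:R) < n.+1%:R by rewrite ltr0n.
rewrite expr_div_n mulrA ltr_pdivrMr ?exprn_gt0//.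
rewrite mulrC ltr_pM2l ?exprn_gt0//.
by rewrite -natrX ltr_nat (leq_trans (ltnSn n))// expnS leq_pmulr// expn1.
Qed.

Lemma eball_center x (r : R) : 0 < r -> eball x r x.
Proof.
move=> r0; apply: enorm_lt_coord => // i.
by rewrite subrr mxE normr0 divr_ge0// ltW.
Qed.

Lemma nbhs_eball x (r : R) : 0 < r -> nbhs x (eball x r).
Proof.
move=> r0; apply/nbhs_ballP; exists (r / n.+1%:R) => /=.
  by rewrite divr_gt0.
move=> y xy; apply: enorm_lt_coord => // i; rewrite !mxE distrC ltW//.
by have [_] := xy; exact.
Qed.

Lemma eball_rat x (r : R) : 0 < r ->
  exists q : 'rV[rat]_n, eball x r (map_mx ratr q).
Proof.
move=> r0; have e0 : 0 < r / n.+1%:R by rewrite divr_gt0.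
have /choice[q qP] : forall i : 'I_n,
    exists q : rat, `|ratr q - x ord0 i| <= r / n.+1%:R.
  move=> i; have [|q] := @rat_in_itvoo R (x ord0 i) (x ord0 i + r / n.+1%:R).
    by rewrite ltrDl.
  rewrite in_itv/= => /andP[xq qx]; exists q.
  by rewrite gtr0_norm ?subr_gt0// lerBlDl ltW.
exists (\row_i q i); apply: enorm_lt_coord => // i.
by rewrite !mxE; exact: qP.
Qed.

End EuclideanNorm.

(** * Disjoint subfamilies *)

(** Disjoint sets meet a countable dense set in different points. *)
Lemma trivIset_countable (T I : choiceType) (Q : countType) (e : Q -> T)
    (D : set I) (B : I -> set T) :
  (forall i, D i -> exists q, B i (e q)) -> trivIset D B -> countable D.
Proof.
move=> De tD.
have /choice[g gP] : forall i, exists q : option Q,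
    D i -> exists2 q', q = Some q' & B i (e q').
  move=> i; have [Di|nDi] := pselect (D i); last by exists None.
  by have [q qP] := De _ Di; exists (Some q) => _; exists q.
apply/countable_injP; exists (fun i => pickle (g i)).
move=> i j /set_mem Di /set_mem Dj /(pcan_inj pickleK) gij.
have [q giq Biq] := gP _ Di; have [q' gjq' Bjq'] := gP _ Dj.
apply: tD => //; exists (e q); split => //.
by move: gij; rewrite giq gjq' => -[->].
Qed.

(** Vitali's selection principle, for sets carrying a bounded size.  Zorn's
    lemma is applied not to all disjoint subfamilies but to the dominated ones,
    where a member of [V] that meets the subfamily meets an element of it at
    least half its size.  Such subfamilies are stable under unions of chains,
    and can be enlarged by a nearly largest member of [V] as long as some
    member of [V] misses them. *)
Lemma vitali_selection (R : realType) (T I : Type) (V : set I) (B : I -> set T)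
    (rad : I -> R) (M : R) :
  (forall i, V i -> B i !=set0) ->
  (forall i, V i -> 0 < rad i <= M)%R ->
  exists2 D, D `<=` V /\ trivIset D B &
    forall i, V i ->
      exists j, [/\ D j, B i `&` B j !=set0 & (rad i <= 2 * rad j)%R].
Proof.
move=> B0 radM.
pose dominated D := forall i, V i -> (exists2 j, D j & B i `&` B j !=set0) ->
  exists j, [/\ D j, B i `&` B j !=set0 & (rad i <= 2 * rad j)%R].
pose P D := [/\ D `<=` V, trivIset D B & dominated D].
have [|A [[AV tA domA] maxA]] := @Zorn_bigcup I P.
  move=> F FP totF; split.
  - by move=> i [D /FP[DV _ _] /DV].
  - move=> i j [D FD Di] [E FE Ej]; have [DE|ED] := totF _ _ FD FE.
      by have [_ + _] := FP _ FE; apply => //; exact: DE.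
    by have [_ + _] := FP _ FD; apply => //; exact: ED.
  - move=> i Vi [j [D FD Dj] Bij].
    have [_ _ /(_ i Vi)[]] := FP _ FD; first by exists j.
    by move=> k [Dk Bik ik]; exists k; split => //; exists D.
exists A => // i Vi; apply: (domA) => //; apply: contrapT => nAi.
(* among the members of V that miss every member of A, take one of nearly
   maximal radius: adding it to A contradicts maximality *)
pose W := V `&` [set k | forall j, A j -> ~ (B k `&` B j !=set0)].
have Wi : W i by split => // j Aj Bij; apply: nAi; exists j.
have supW : has_sup (rad @` W).
  split; first by exists (rad i), i.
  by exists M => _ [k [Vk _] <-]; have /andP[] := radM _ Vk.
have sup0 : (0 < sup (rad @` W))%R.
  have /andP[+ _] := radM _ Vi; move=> /lt_le_trans; apply.
  by apply: ub_le_sup; [exact: supW.2|exists i].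
have [_ [k [Vk Wk] <-] supk] := sup_adherent (divr_gt0 sup0 (ltr0Sn R 1)) supW.
have Bkk : B k `&` B k !=set0 by rewrite setIid; exact: B0.
apply: (maxA (A `|` [set k])).
  split; first by move=> j Aj; left.
  by move=> /(_ k (or_intror erefl)) Ak; exact: (Wk k).
split.
- by move=> j [/AV//|->].
- move=> j l [Aj|->] [Al|->]//; first exact: tA.
  + by rewrite setIC => /(Wk _ Aj).
  + by move/(Wk _ Al).
- have domj j : V j -> (exists2 l, A l & B j `&` B l !=set0) ->
      exists l, [/\ (A `|` [set k]) l, B j `&` B l !=set0
        & (rad j <= 2 * rad l)%R].
    by move=> Vj /(domA _ Vj)[m [Am Bjm jm]]; exists m; split => //; left.
  move=> j Vj [l [Al|->] Bjl]; first by apply: domj => //; exists l.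
  have [|nAj] := pselect (exists2 l, A l & B j `&` B l !=set0).
    exact: domj.
  exists k; split => //; first by right.
  have jsup : (rad j <= sup (rad @` W))%R.
    apply: ub_le_sup; first exact: supW.2.
    by exists j => //; split => // m Am Bjm; apply: nAj; exists m.
  by lra.
Qed.

(** * Lebesgue measurability of Euclidean balls *)

(** The length of an interval [u, v], possibly empty, cut at [a]. *)
Lemma max0_split (R : realDomainType) (u v a : R) :
  (Num.max 0 (v - u) =
   Num.max 0 (Num.min v a - u) + Num.max 0 (v - Num.max u a))%R.
Proof.
case: (leP v a) => va; case: (leP u a) => ua.
- by rewrite (@max_l _ _ 0%R (v - a)%R) ?addr0//; lra.
- by rewrite max_l ?addr0//; lra.
- by rewrite !max_r; lra.
- by rewrite (@max_l _ _ 0%R (a - u)%R) ?add0r//; lra.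
Qed.

(** The map [f] may identify indices, whose terms are then counted once on the
    left: sum on the right over a section of [f] only. *)
Lemma esum_image_le (R : realType) (T T' : choiceType) (D : set T) (f : T -> T')
    (a : T' -> \bar R) : (forall y, 0 <= a y) ->
  \esum_(y in f @` D) a y <= \esum_(x in D) a (f x).
Proof.
move=> a0.
have [D0|/set0P[x0 Dx0]] := eqVneq D set0.
  by rewrite D0 image_set0 !esum_set0.
have /choice[g gP] : forall y, exists x, (f @` D) y -> D x /\ f x = y.
  move=> y; have [[x Dx <-]|] := pselect ((f @` D) y); first by exists x.
  by exists x0.
rewrite (eq_esum (b := fun y => a (f (g y)))); last first.
  by move=> y /gP[_ ->].
rewrite -(esum_image _ g (a \o f))/=; last first.
  by move=> y z /set_mem/gP[_ fy] /set_mem/gP[_ fz] gyz; rewrite -fy -fz gyz.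
rewrite [leRHS](esumID (g @` (f @` D)))//.
rewrite setIidr; last by move=> _ [y /gP[Dy _] <-].
by rewrite leeDl//; exact: esum_ge0.
Qed.

Section Measurability.
Context {R : realType} {n : nat}.
Local Notation V := 'rV[R]_n.
Local Notation leb := (lebesgue_outer (R := R) (n := n)).
Implicit Types (b : V * V) (i : 'I_n) (a : R).

Definition set_coord (x : V) i a : V :=
  \row_j (if j == i then a else x ord0 j).

Definition box_below i a b := (b.1, set_coord b.2 i (Num.min (b.2 ord0 i) a)).

Definition box_above i a b := (set_coord b.1 i (Num.max (b.1 ord0 i) a), b.2).

Lemma box_belowE i a b :
  box (box_below i a b) = box b `&` [set x : V | (x ord0 i <= a)%R].
Proof.
apply/seteqP; split => [x /= bx|x [bx /= xa] j] /=.
  split=> [j|]; last first.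
    by have := bx i; rewrite mxE eqxx le_min => /and3P[].
  have := bx j; rewrite mxE; case: eqP => [->|//].
  by rewrite le_min => /and3P[-> ->].
by have := bx j; rewrite mxE; case: eqP => [->|//]; rewrite le_min xa andbT.
Qed.

Lemma box_aboveE i a b :
  box (box_above i a b) = box b `&` ~` [set x : V | (x ord0 i <= a)%R].
Proof.
apply/seteqP; split => [x /= bx|x [bx /negP]] /=.
  split=> [j|]; last first.
    have := bx i; rewrite mxE eqxx gt_max => /andP[/andP[_ ax] _].
    by apply/negP; rewrite -ltNge.
  have := bx j; rewrite mxE; case: eqP => [->|//].
  by rewrite gt_max => /andP[/andP[-> _] ->].
rewrite -ltNge => ax j.
by have := bx j; rewrite mxE; case: eqP => [->|//]; rewrite gt_max ax andbT.
Qed.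

Lemma box_vol_split i a b :
  box_vol b = (box_vol (box_below i a b) + box_vol (box_above i a b))%R.
Proof.
have prodD1 (F : 'I_n -> R) :
  (\prod_(j < n) F j = F i * \prod_(j < n | j != i) F j)%R by exact: bigD1.
rewrite /box_vol !prodD1/= !mxE eqxx.
set u := Num.max (b.1 ord0 i) a; set v := Num.min (b.2 ord0 i) a.
have -> : (\prod_(j < n | j != i)
      Num.max 0 (set_coord b.2 i v ord0 j - b.1 ord0 j) =
    \prod_(j < n | j != i) Num.max 0 (b.2 ord0 j - b.1 ord0 j))%R.
  by apply: eq_bigr => j /negbTE ji; rewrite mxE ji.
have -> : (\prod_(j < n | j != i)
      Num.max 0 (b.2 ord0 j - set_coord b.1 i u ord0 j) =
    \prod_(j < n | j != i) Num.max 0 (b.2 ord0 j - b.1 ord0 j))%R.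
  by apply: eq_bigr => j /negbTE ji; rewrite mxE ji.
by rewrite -mulrDl (max0_split _ _ a).
Qed.

Lemma box_vol_ge0 b : 0 <= (box_vol b)%:E.
Proof. by rewrite lee_fin; apply: prodr_ge0 => i _; rewrite le_max lexx. Qed.

Lemma lebesgue_outer_le (X : set V) (D : set (V * V)) (c : V * V -> V * V) :
  countable D -> X `<=` \bigcup_(b in D) box (c b) ->
  leb X <= \esum_(b in D) (box_vol (c b))%:E.
Proof.
move=> cD XD.
have := @esum_image_le R _ _ D c (fun b => (box_vol b)%:E) box_vol_ge0.
apply: le_trans; apply: ereal_inf_lbound; exists (c @` D) => //; split.
  exact: sub_countable (card_image_le _ _) cD.
by move=> x /XD[b Db xb]; exists (c b).
Qed.

(** Every cover by boxes of a set is cut by the hyperplane into covers of its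
    two parts, with the same total volume. *)
Lemma caratheodory_half_space i a :
  caratheodory_measurable leb [set x : V | (x ord0 i <= a)%R].
Proof.
apply: le_caratheodory_measurable => X.
apply: le_ereal_inf_tmp => _ [D [cD XD] <-].
under eq_esum do rewrite (box_vol_split i a) EFinD.
rewrite esumD; [|by move=> *; exact: box_vol_ge0..].
apply: leeD; apply: lebesgue_outer_le => // x [/XD[b Db xb] xa]; exists b => //.
  by rewrite box_belowE.
by rewrite box_aboveE.
Qed.

Lemma measurable_coord i :
  measurable_fun [set: lebRn R n] (fun x : lebRn R n => (x : V) ord0 i).
Proof.
apply: (measurability _ (RGenOInfty.measurableE R)) => //.
move=> _ [_ [a ->] <-]; rewrite setTI.
rewrite (_ : _ @^-1` _ = ~` [set x : V | (x ord0 i <= a)%R]); last first.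
  apply/seteqP; split => x /=; rewrite in_itv/= andbT ltNge; first by move/negP.
  by move=> /negP.
by apply: (@measurableC _ (lebRn R n)); exact: caratheodory_half_space.
Qed.

Lemma measurable_eball (x : V) (r : R) :
  (0 < r)%R -> measurable (eball x r : set (lebRn R n)).
Proof.
move=> r0.
pose f (y : lebRn R n) := (\sum_(i < n) ((y : V) ord0 i - x ord0 i) ^+ 2)%R.
have mf : measurable_fun setT f.
  apply: (@measurable_sum _ (lebRn R n) R setT) => i.
  apply: measurable_funX; apply: measurable_funB; first exact: measurable_coord.
  exact: measurable_cst.
rewrite (_ : eball x r = setT `&` f @^-1` `]-oo, (r ^+ 2)%R[%classic).
  by apply: mf => //; exact: measurable_itv.
have fE y : f y = (enorm ((y : V) - x) ^+ 2)%R.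
  by rewrite sqr_enorm; apply: eq_bigr => i _; rewrite !mxE.
rewrite setTI; apply/seteqP; split => y;
  by rewrite /eball/= in_itv/= fE ltr_pXn2r// ?nnegrE ?enorm_ge0 ?ltW.
Qed.

End Measurability.

(** * Countable subadditivity of the weighted measure *)

(** Both sides are suprema over simple functions, and those below the first
    integrand are among those below the second; so this applies to a set that
    is not known to be measurable. *)
Lemma ge0_subset_integral_any d (T : measurableType d) (R : realType)
    (mu : {measure set T -> \bar R}) (A B : set T) (f g : T -> \bar R) :
  (forall x, 0 <= f x) -> (forall x, A x -> f x <= g x) ->
  (forall x, B x -> 0 <= g x) -> A `<=` B ->
  \int[mu]_(x in A) f x <= \int[mu]_(x in B) g x.
Proof.
move=> f0 fg g0 AB; rewrite !ge0_integralE//.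
apply: ge_ereal_sup => _ [h /= hf <-]; apply: ereal_sup_ubound.
exists h => // x.
apply: (le_trans (hf x)); rewrite /patch; case: ifPn => [/set_mem Ax|_].
  by rewrite mem_set ?fg//; exact: AB.
by case: ifPn => // /set_mem/g0.
Qed.

Section WeightedMeasure.
Context {R : realType} {n : nat} (w : 'rV[R]_n -> R).
Hypothesis mw : lebesgue_measurable_fun w.
Hypothesis w0 : forall x, (0 <= w x)%R.
Local Notation V := 'rV[R]_n.
Local Notation mu := (lebesgue_rV R n).

Lemma wmeas_ge0 (E : set V) : 0 <= wmeas w E.
Proof. by apply: integral_ge0 => x _; rewrite lee_fin. Qed.

(** As [E] may fail to be measurable, the subadditivity of a measure does not
    apply; instead [w] on [E] is dominated pointwise by the sum of its
    restrictions to the [A k], which can be integrated termwise. *)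
Lemma wmeas_bigcup_le (E : set V) (A : nat -> set V) :
  (forall k, measurable (A k : set (lebRn R n))) -> E `<=` \bigcup_k A k ->
  wmeas w E <= \sum_(k <oo) wmeas w (A k).
Proof.
move=> mA EA.
pose F k : lebRn R n -> \bar R := (fun x => (w x)%:E) \_ (A k).
have F0 k x : 0 <= F k x.
  by rewrite /F /patch; case: ifP => // _; rewrite lee_fin.
have -> : \sum_(k <oo) wmeas w (A k) = \sum_(k <oo) \int[mu]_(x in setT) F k x.
  by apply: eq_eseriesr => k _; rewrite /wmeas integral_mkcond.
rewrite -integral_nneseries//; last first.
  move=> k; apply/(measurable_restrictT _ (mA k)).
  apply: measurable_funTS; apply/measurable_EFinP; exact: mw.
apply: ge0_subset_integral_any => //.
- move=> x /EA[k _ Akx].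
  apply: (@le_trans _ _ (F k x)); first by rewrite /F /patch mem_set.
  by rewrite (@nneseriesD1 _ _ k)//= leeDl// nneseries_ge0.
- by move=> x _; exact: nneseries_ge0.
Qed.

Lemma wmeas_cover_le (I : pointedType) (D : set I) (B : I -> set V)
    (u : I -> \bar R) (c : R) (E : set V) : (0 <= c)%R ->
  countable D -> (forall i, D i -> measurable (B i : set (lebRn R n))) ->
  E `<=` \bigcup_(i in D) B i ->
  (forall i, D i -> 0 <= u i) ->
  (forall i, D i -> wmeas w (B i) <= c%:E * u i) ->
  wmeas w E <= c%:E * \esum_(i in D) u i.
Proof.
move=> c0 /countable_bijP[N]; rewrite card_eq_sym => /card_set_bijP[e eND].
move=> mB EB u0 Bu.
have [De surj] : (forall k, N k -> D (e k)) /\ D `<=` e @` N.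
  by case: eND.
rewrite (reindex_esum N D e)// esum_mkcond -nneseries_esumT; last first.
  by move=> k; case: ifPn => // /set_mem/De/u0.
rewrite -nneseriesZl; last by move=> k _; case: ifPn => // /set_mem/De/u0.
pose A k := if k \in N then B (e k) else set0.
apply: (@le_trans _ _ (\sum_(k <oo) wmeas w (A k))).
  apply: wmeas_bigcup_le.
    move=> k; rewrite /A; case: ifPn => [/set_mem/De|_]; first exact: mB.
    exact: (@measurable0 _ (lebRn R n)).
  move=> x /EB[_ /surj[k Nk <-] xB]; exists k => //.
  by rewrite /A mem_set.
apply: lee_nneseries => [k _ _|k _]; first exact: wmeas_ge0.
rewrite /A; case: ifPn => [/set_mem/De/Bu//|_].
by rewrite mule0 /wmeas integral_set0.
Qed.

End WeightedMeasure.

(** * Balls on which the oscillation is large *)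

Section LipschitzBalls.
Context {R : realType} {n : nat}.
Implicit Types (f w : 'rV[R]_n -> R) (x : 'rV[R]_n).

Lemma oscillation_ge f (E : set 'rV[R]_n) x y : E x -> E y ->
  (`|f x - f y|)%:E <= oscillation E f.
Proof. by move=> Ex Ey; apply: ereal_sup_ubound; exists (x, y). Qed.

(** The ball is centred at [x] and has radius [2|x - y|] for a point [y] with
    [|x - y| < 1] and a difference quotient above [t]; the factor 2 puts [y]
    inside the open ball and is what halves [t]. *)
Lemma local_lip_ball f x (t : R) : t%:E < local_lip f x ->
  exists2 r, (0 < r <= 2)%R &
    (t / 2)%:E <= oscillation (eball x r) f * (r^-1)%:E.
Proof.
move=> tL.
have : t%:E < ereal_sup ((fun y => (`|f x - f y| / enorm (x - y))%:E) @`
    [set y | eball x 1 y /\ y != x]).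
  apply: (lt_le_trans tL); apply: ereal_inf_lbound.
  exists [set y | eball x 1 y /\ y != x] => //.
  have : nbhs x (eball x 1) by exact: nbhs_eball.
  rewrite /dnbhs /within/=; apply: filterS => y xy yx; split => //.
move=> /ereal_sup_gt[_ [y [xy1 yx] <-]]; rewrite lte_fin => tq.
set d := enorm (x - y) in tq.
have d0 : (0 < d)%R.
  rewrite lt_def enorm_ge0 andbT; apply: contra yx => /eqP/enorm_eq0/eqP.
  by rewrite subr_eq0 eq_sym.
have d1 : (d < 1)%R by rewrite /d enormB.
exists (2 * d)%R; first by apply/andP; split; lra.
have xB : eball x (2 * d) x by apply: eball_center; lra.
have yB : eball x (2 * d) y by rewrite /eball/= enormB -/d; lra.
apply: le_trans (lee_wpmul2r _ (oscillation_ge f xB yB)); last first.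
  by rewrite lee_fin invr_ge0; lra.
rewrite -EFinM lee_fin invfM mulrCA mulrC ler_pM2l ?invr_gt0//.
exact: ltW.
Qed.

Lemma doubling_quadruple w (C' : R) : weight w ->
  (forall x (r : R), (0 < r)%R ->
    wmeas w (eball x (2 * r)) <= C'%:E * wmeas w (eball x r)) ->
  forall x (r : R), (0 < r)%R ->
    wmeas w (eball x (4 * r)) <= (Num.max 1 C' ^+ 2)%R%:E * wmeas w (eball x r).
Proof.
move=> [_ w0 _] dw; set K := (Num.max 1 C')%R => x r r0.
have K0 : (0 <= K)%R by rewrite le_max ler01.
have dwK s : (0 < s)%R ->
    wmeas w (eball x (2 * s)) <= K%:E * wmeas w (eball x s).
  move=> s0; apply: (le_trans (dw _ _ s0)); apply: lee_wpmul2r.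
    exact: wmeas_ge0.
  by rewrite lee_fin le_max lexx orbT.
rewrite (_ : 4 * r = 2 * (2 * r))%R; last by lra.
apply: (le_trans (dwK _ _)); first by rewrite mulr_gt0.
by rewrite expr2 EFinM -muleA lee_wpmul2l// dwK.
Qed.

(** Here [|x - y| < r + s <= 3 s].  Only the centre [x] has to be covered, not
    the whole ball as in the usual factor 5, and 4 is a power of 2, which suits
    the doubling condition. *)
Lemma eball_meet_sub4 x y (r s : R) : eball x r `&` eball y s !=set0 ->
  (r <= 2 * s)%R -> eball y (4 * s) x.
Proof.
move=> [z []]; rewrite /eball/= => zx zy rs.
have : (enorm (x - y) <= enorm (x - z) + enorm (z - y))%R.
  by rewrite -[(x - y)%R](subrKA z) enormD.
by rewrite [enorm (x - z)]enormB; have := enorm_ge0 (z - y); lra.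
Qed.

Lemma eball_packing (V : set ('rV[R]_n * R)) (M : R) :
  (forall b, V b -> 0 < b.2 <= M)%R ->
  exists D, [/\ D `<=` V, ball_packing D &
    forall b, V b -> exists2 b', D b' & eball b'.1 (4 * b'.2) b.1].
Proof.
move=> VM.
have V0 b : V b -> (0 < b.2)%R by move=> /VM/andP[].
have [|D [DV tD] Dsel] := @vitali_selection R _ _ V
    (fun b => eball b.1 b.2) snd M _ VM.
  by move=> b /V0 b0; exists b.1; exact: eball_center.
exists D; split => //; first split => //.
- apply: (@trivIset_countable _ _ _ (map_mx ratr) D) tD => b /DV/V0.
  exact: eball_rat.
- by move=> b /DV/V0.
- move=> b /Dsel[b' [Db' bb' rr']]; exists b' => //.
  exact: eball_meet_sub4 bb' rr'.
Qed.

End LipschitzBalls.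

(** * The weak-type estimate *)

Theorem corollary1p6 (R : realType) (n : nat) (hn : (0 < n)%N)
  (p : R) (hp : (1 <= p)%R)
  (w : 'rV[R]_n -> R) (hw : weight w) (hdw : doubling w) :
  exists2 C : R, (0 < C)%R &
    forall f : 'rV[R]_n -> R, RBV p w f ->
    forall t : R, (0 < t)%R ->
      wmeas w [set x | t%:E < local_lip f x]
        <= C%:E * (riesz_variation p w f * (t^-1)%:E) `^ p.
Proof.
have [C' dw] := hdw; have [mw w0 _] := hw.
have p0 : (0 < p)%R by lra.
(* C' may be negative when w vanishes; the maximum keeps the constant positive *)
set K := Num.max 1%R C'.
have K0 : (0 < K)%R by rewrite lt_max ltr01.
exists (K ^+ 2 * 2 `^ p)%R; first by rewrite mulr_gt0 ?exprn_gt0 ?powR_gt0.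
move=> f _ t t0.
pose V := [set b : 'rV[R]_n * R | (0 < b.2 <= 2)%R /\
  (t / 2)%:E <= oscillation (eball b.1 b.2) f * (b.2^-1)%:E].
have [D [DV packD coverD]] : exists D, [/\ D `<=` V, ball_packing D &
    forall b, V b -> exists2 b', D b' & eball b'.1 (4 * b'.2) b.1].
  by apply: (@eball_packing _ _ _ 2) => b [].
have [cD D0 tD] := packD.
set S := ereal_sup [set riesz_sum p w f D | D in ball_packing].
have SD : riesz_sum p w f D <= S by apply: ereal_sup_ubound; exists D.
have term0 b : 0 <= (oscillation (eball b.1 b.2) f * (b.2^-1)%:E) `^ p
    * wmeas w (eball b.1 b.2) by rewrite mule_ge0 ?poweR_ge0 ?wmeas_ge0.
have S0 : 0 <= S by apply: le_trans SD; apply: esum_ge0.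
have -> : (riesz_variation p w f * (t^-1)%:E) `^ p = (t^-1 `^ p)%:E * S.
  rewrite poweRM ?poweR_ge0 ?lee_fin ?invr_ge0 ?ltW// muleC; congr (_ * _).
  by rewrite /riesz_variation -poweRrM mulVf ?gt_eqF// poweRe1.
have c0 : (0 <= K ^+ 2 * (2 / t) `^ p)%R.
  by rewrite mulr_ge0 ?exprn_ge0 ?powR_ge0 ?ltW.
rewrite muleA -EFinM -mulrA -powRM ?invr_ge0 ?(ltW t0)//.
apply: (@le_trans _ _
    ((K ^+ 2 * (2 / t) `^ p)%:E * riesz_sum p w f D)); last first.
  by rewrite lee_wpmul2l.
apply: (@wmeas_cover_le _ _ _ mw w0 _ D (fun b => eball b.1 (4 * b.2))) => //.
- by move=> b /D0 b0; apply: measurable_eball; rewrite mulr_gt0.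
- move=> x /= /local_lip_ball[r r2 osc].
  by have [b Db xb] := coverD (x, r) (conj r2 osc); exists b.
move=> b Db; have [/andP[b0 _] osc] := DV _ Db.
(* termwise: w(4B) <= K^2 w(B), and 1 <= (2/t)^p (osc_B(f) / r)^p *)
apply: (le_trans (doubling_quadruple hw dw b.1 b0)).
rewrite -/K [X in _ <= X * _]EFinM -[leRHS]muleA; apply: lee_wpmul2l.
  by rewrite lee_fin exprn_ge0// ltW.
rewrite muleA -[leLHS]mul1e; apply: lee_wpmul2r; first exact: wmeas_ge0.
have -> : 1 = ((2 / t) `^ p)%:E * ((t / 2) `^ p)%:E :> \bar R.
  rewrite -EFinM -powRM ?divr_ge0 ?ltW// -[(t / 2)%R]invf_div divff ?powR1//.
  by rewrite gt_eqF// divr_gt0.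
apply: lee_wpmul2l; first by rewrite lee_fin powR_ge0.
rewrite -poweR_EFin.
apply: gt0_ler_poweR => //; first exact: ltW.
- by rewrite in_itv/= leey lee_fin divr_ge0 ?ltW.
- by rewrite in_itv/= leey (le_trans _ osc)// lee_fin divr_ge0 ?ltW.
Qed.
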